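(* Let $\lambda\in\mathbb{C}$ and let $H,T,S$ be operators on the Hilbert space $\mathcal{H}$, all leaving, together with their adjoints, a dense subspace $\mathcal{D}$ stable. Assume that $[H,S]=\lambda S[T,S]$ (that is, $(H,T,S)\in\mathcal{R}_\lambda$), that $[H,[T,S]]=0$, and that all the eigenvalues of $H$ are non-degenerate (have multiplicity one). Suppose further that there is a non-zero $\varphi_0\in\mathcal{D}$ with $H\varphi_0=0$. Put $\varphi_n=S^n\varphi_0$ for $n\ge 0$, and assume that $\varphi_n\neq 0$ for all $n\geq 0$. Then, for all $n\ge 0$, $$[T,S]\varphi_n=\mu_n\varphi_n,\qquad \mu_n=\frac{\langle\varphi_n,[T,S]\varphi_n\rangle}{\|\varphi_n\|^2},$$ and $$H\varphi_n=E_n\varphi_n,$$ where $$E_0=0,\qquad E_n=E_{n-1}+\lambda\mu_{n-1}=\lambda\sum_{k=0}^{n-1}\mu_k,\quad n\ge 1.$$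
   Context: $\mathcal{H}$ is a complex Hilbert space with scalar product $\langle\cdot,\cdot\rangle$ (linear in the second variable) and norm $\|\cdot\|$. Standing assumption: there is a dense subspace $\mathcal{D}\subseteq\mathcal{H}$ which is contained in the domains of $H,T,S$ and of their adjoints $H^\dagger,T^\dagger,S^\dagger$ and is mapped into itself by all these (possibly unbounded) operators. The operators are regarded as maps $\mathcal{D}\to\mathcal{D}$; all operator identities are identities on $\mathcal{D}$, and $[X,Y]=XY-YX$. $H$ is not assumed self-adjoint. Non-degeneracy of the eigenvalues of $H$ means that for each $E\in\mathbb{C}$ the space $\{f\in\mathcal{D}: Hf=Ef\}$ has dimension at most one. *)

(* Defs.v *)
From HB Require Import structures.
From mathcomp Require Export all_boot all_order all_algebra sesquilinear.
From mathcomp Require Export complex.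
From mathcomp Require Export all_classical all_reals all_analysis.

Set Implicit Arguments.
Unset Strict Implicit.
Unset Printing Implicit Defensive.

Import Order.TTheory GRing.Theory Num.Theory.
Export numFieldNormedType.Exports.

Local Open Scope classical_set_scope.
Local Open Scope complex_scope.
Local Open Scope ring_scope.

(* A Hilbert space is a complete normed space over [R[i]] together with a
   positive definite hermitian form inducing its norm. Library forms are linear
   in the first variable, so [<x, y>] is [ip y x], linear in [y]. *)
Record inner_product (R : realType) (V : completeNormedModType R[i]) :=
  InnerProduct {
    ip_form :> {dot V for Num.conj};
    ip_normE : forall x : V, ip_form x x = `|x| ^+ 2 }.

Definition scalprod (R : realType) (V : completeNormedModType R[i])
  (ip : inner_product V) (x y : V) : R[i] := ip y x.

Definition is_subspace (K : nzRingType) (V : lmodType K) (A : set V) : Prop :=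
  A 0 /\ forall (a : K) (x y : V), A x -> A y -> A (a *: x + y).

(* A possibly unbounded operator; the values of [op] outside [dom] are
   irrelevant. *)
Record operator (K : nzRingType) (V : lmodType K) := Operator {
  dom : set V;
  op :> V -> V;
  dom_subspace : is_subspace dom;
  op_linear : forall (a : K) (x y : V), dom x -> dom y ->
    op (a *: x + y) = a *: op x + op y }.

Section HilbertOperators.
Variables (R : realType) (V : completeNormedModType R[i]).
Variable (ip : inner_product V).

Definition adjoint_at (X : operator V) (y z : V) : Prop :=
  forall x, dom X x -> scalprod ip y (X x) = scalprod ip z x.

Definition adjoint_dom (X : operator V) : set V :=
  [set y | exists z, adjoint_at X y z].

(* For densely defined [X] the chosen [z] is unique. *)
Definition adjoint (X : operator V) (y : V) : V :=
  xget 0 [set z | adjoint_at X y z].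

Definition stable_core (D : set V) (X : operator V) : Prop :=
  [/\ D `<=` dom X, D `<=` adjoint_dom X,
      forall f, D f -> D (X f) & forall f, D f -> D (adjoint X f)].

End HilbertOperators.

Definition comm (V : zmodType) (X Y : V -> V) (f : V) : V :=
  X (Y f) - Y (X f).

Definition in_Rclass (K : nzRingType) (V : lmodType K) (D : set V)
  (lambda : K) (H T S : V -> V) : Prop :=
  forall f, D f -> comm H S f = lambda *: S (comm T S f).

Definition eigenspace_on (K : nzRingType) (V : lmodType K) (D : set V)
  (H : V -> V) (E : K) : set V := [set f | D f /\ H f = E *: f].

Definition dim_le1 (K : nzRingType) (V : lmodType K) (A : set V) : Prop :=
  exists e : V, A `<=` [set c *: e | c in [set: K]].

Definition nondegenerate_on (K : nzRingType) (V : lmodType K) (D : set V)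
  (H : V -> V) : Prop := forall E : K, dim_le1 (eigenspace_on D H E).

Definition ladder (V : Type) (S : V -> V) (phi0 : V) (n : nat) : V :=
  iter n S phi0.

Fixpoint energy (K : nzRingType) (lambda : K) (mu : nat -> K) (n : nat) : K :=
  if n is m.+1 then energy lambda mu m + lambda * mu m else 0.

(* Main.v *)
Require Import Defs.

(* Since [T, S] commutes with H, it preserves each eigenspace of H; these being
   at most one-dimensional, [T, S] phi_n = c phi_n, and pairing with phi_n gives
   c = mu_n. Then H S phi_n = S H phi_n + lambda S [T, S] phi_n raises the
   eigenvalue by lambda mu_n. *)

Import Order.TTheory GRing.Theory Num.Theory.
Local Open Scope classical_set_scope.
Local Open Scope complex_scope.
Local Open Scope ring_scope.

(** Linearity at [a = 1] and [x = y = 0] gives [X 0 = X 0 + X 0]. *)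
Lemma op0 (K : nzRingType) (V : lmodType K) (X : operator V) : X 0 = 0.
Proof.
have [dom0 _] := dom_subspace X.
have := op_linear 1 dom0 dom0.
by rewrite !scale1r addr0 => /eqP; rewrite -subr_eq subrr eq_sym => /eqP.
Qed.

Lemma opZ (K : nzRingType) (V : lmodType K) (X : operator V) (a : K) (x : V) :
  dom X x -> X (a *: x) = a *: X x.
Proof.
move=> domx; have [dom0 _] := dom_subspace X.
by rewrite -[a *: x]addr0 op_linear// op0 addr0.
Qed.

Lemma is_subspaceB (K : nzRingType) (V : lmodType K) (A : set V) (x y : V) :
  is_subspace A -> A x -> A y -> A (x - y).
Proof.
by case=> _ Alin Ax Ay; rewrite addrC -scaleN1r; exact: Alin.
Qed.

Lemma comm_opZ (K : nzRingType) (V : lmodType K) (X Y : operator V) (a : K)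
  (x : V) : dom X x -> dom Y x -> dom X (Y x) -> dom Y (X x) ->
  comm X Y (a *: x) = a *: comm X Y x.
Proof. by move=> Xx Yx XYx YXx; rewrite /comm !opZ// scalerBr. Qed.

(** If [x = a *: e] is non-zero then [a] is invertible, so [y = b *: e] is [(b / a) *: x]. *)
Lemma dim_le1_scale (K : fieldType) (V : lmodType K) (A : set V) (x y : V) :
  dim_le1 A -> A x -> x != 0 -> A y -> exists c, y = c *: x.
Proof.
move=> [e Ae] /Ae[a _ <-] + /Ae[b _ <-].
rewrite scaler_eq0 negb_or => /andP[a0 _].
by exists (b / a); rewrite scalerA divfK.
Qed.

(** The scalar comes out of the linear slot, hence without conjugation. *)
Lemma rayleigh_quotient (R : realType) (V : completeNormedModType R[i])
  (ip : inner_product V) (c : R[i]) (x : V) :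
  x != 0 -> scalprod ip x (c *: x) / `|x| ^+ 2 = c.
Proof.
by move=> x0; rewrite /scalprod linearZl_LR/= ip_normE mulfK// sqrf_eq0 normr_eq0.
Qed.

Lemma energyE (K : nzRingType) (lambda : K) (mu : nat -> K) (n : nat) :
  energy lambda mu n = lambda * \sum_(0 <= k < n) mu k.
Proof.
elim: n => [|n IHn] /=; first by rewrite big_geq// mulr0.
by rewrite big_nat_recr//= mulrDr IHn.
Qed.

Theorem theorem3 (R : realType) (V : completeNormedModType R[i])
  (ip : inner_product V) (lambda : R[i]) (H T S : operator V)
  (D : set V) (phi0 : V) :
  is_subspace D -> dense D ->
  stable_core ip D H -> stable_core ip D T -> stable_core ip D S ->
  in_Rclass D lambda H T S ->
  (forall f, D f -> comm H (comm T S) f = 0) ->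
  nondegenerate_on D H ->
  D phi0 -> phi0 != 0 -> H phi0 = 0 ->
  let phi := ladder S phi0 in
  (forall n : nat, phi n != 0) ->
  let mu (n : nat) := scalprod ip (phi n) (comm T S (phi n)) / `|phi n| ^+ 2 in
  let E := energy lambda mu in
  [/\ forall n : nat, comm T S (phi n) = mu n *: phi n,
      forall n : nat, H (phi n) = E n *: phi n,
      E 0%N = 0
    & forall n : nat, (0 < n)%N ->
        E n = E n.-1 + lambda * mu n.-1 /\
        E n = lambda * \sum_(0 <= k < n) mu k].
Proof.
move=> Dsub _ [Hdom _ HD _] [Tdom _ TD _] [Sdom _ SD _] HR HC Hnd D0 _ H0.
move=> phi phi_neq0 mu E.
have Dphi n : D (phi n) by elim: n => //= n IHn; exact: SD.
have DC f : D f -> D (comm T S f).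
  by move=> Df; apply: is_subspaceB => //; [exact/TD/SD|exact/SD/TD].
(* Kept conditional on the eigenvalue equation at [n], because the induction proving [HE] uses it at
   each step. *)
have CE n : H (phi n) = E n *: phi n -> comm T S (phi n) = mu n *: phi n.
  move=> HE; have Df := Dphi n.
  have [] := dim_le1_scale _ _ _ _ (comm T S (phi n)) (Hnd (E n)) (conj Df HE)
    (phi_neq0 n).
    split; first exact: DC.
    (* Only the outer commutator is unfolded: [H] applied to [[T, S] phi_n] equals [[T, S]] applied
       to [E n *: phi n], and the scalar is then pulled out. *)
    move/eqP: (HC _ Df); rewrite {1}/comm subr_eq0 HE => /eqP ->.
    by rewrite comm_opZ//; [exact: Tdom|exact: Sdom|exact/Tdom/SD|exact/Sdom/TD].
  by move=> c Cc; rewrite /mu Cc rayleigh_quotient.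
have HE n : H (phi n) = E n *: phi n.
  elim: n => [|n IHn]; first by rewrite scale0r.
  have := HR _ (Dphi n).
  (* With both eigenvalue equations at [n], the relation becomes [H (S phi_n) - E n *: S phi_n =
     lambda *: (mu n *: S phi_n)]. *)
  rewrite (CE _ IHn) {1}/comm IHn !opZ; [|exact/Sdom..].
  by move/eqP; rewrite subr_eq scalerA -scalerDl addrC => /eqP.
(* [E 0 = 0] and the recurrence hold by computation. *)
split => // [n|[//|n] _]; first exact: CE.
by split => //; exact: energyE.
Qed.
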